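(* Let $n\ge 4$ and let $i\in\{1,2,\ldots,n-2\}$. Then the graphs $K_{n,n}\boxtimes K_2$ and $K_{n+i,n,n,n-i}$ are not $\varepsilon$-cospectral, and they are $\varepsilon$-equienergetic, i.e. $E_{\varepsilon}(K_{n,n}\boxtimes K_2)=E_{\varepsilon}(K_{n+i,n,n,n-i})$.
   Context: All graphs are finite, undirected, without loops or multiple edges. For a connected graph $G$, $d_G(u,v)$ is the distance between vertices $u,v$, and the eccentricity of $u$ is $\varepsilon(u)=\max\{d_G(u,v): v\in V(G)\}$. The eccentricity matrix $\varepsilon(G)=(\epsilon_{uv})$ is the symmetric matrix indexed by $V(G)$ with $\epsilon_{uv}=d_G(u,v)$ if $d_G(u,v)=\min\{\varepsilon(u),\varepsilon(v)\}$ and $\epsilon_{uv}=0$ otherwise. The $\varepsilon$-spectrum of $G$ is the multiset of eigenvalues of $\varepsilon(G)$, and the $\varepsilon$-energy $E_{\varepsilon}(G)$ is the sum of the absolute values of these eigenvalues, counted with multiplicity. Two graphs are $\varepsilon$-cospectral if they have the same $\varepsilon$-spectrum, and $\varepsilon$-equienergetic if they have the same $\varepsilon$-energy. The complete multipartite graph $K_{n_1,\ldots,n_p}$ has vertex set partitioned into parts of sizes $n_1,\ldots,n_p$, two vertices being adjacent if and only if they lie in different parts. The strong product $G\boxtimes H$ of $G=(V,E)$ and $H=(W,F)$ has vertex set $V\times W$; two distinct vertices $(v_1,w_1)$ and $(v_2,w_2)$ are adjacent if and only if ($v_1=v_2$ or $v_1v_2\in E$) and ($w_1=w_2$ or $w_1w_2\in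 F$). *)

(* Defs.v *)
From mathcomp Require Import all_boot all_order all_algebra.

Set Implicit Arguments.
Unset Strict Implicit.
Unset Printing Implicit Defensive.

Import GRing.Theory Num.Theory.

Record sgraph := SGraph {
  vertex :> finType;
  adj : rel vertex;
  adj_sym : symmetric adj;
  adj_irrefl : irreflexive adj }.

Section Distance.
Variable G : sgraph.
Implicit Types u v : G.

Definition walk u v (k : nat) : bool :=
  [exists p : k.-tuple G, path (@adj G) u p && (last u p == v)].

(* The least k < #|G| such that some walk of length k joins u to v; the value
   is the junk #|G| when u and v lie in different components. *)
Definition dist u v : nat := find (walk u v) (iota 0 #|G|).

Definition ecc u : nat := \max_(v : G) dist u v.

Lemma walkP u v k :
  reflect (exists p : seq G, [/\ size p = k, path (@adj G) u p & last u p = v])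
          (walk u v k).
Proof.
apply: (iffP existsP) => [[p /andP[pp /eqP lp]] | [p [sp pp lp]]].
  by exists p; rewrite size_tuple.
have sp' : size p == k by apply/eqP.
by exists (Tuple sp') => /=; rewrite pp lp eqxx.
Qed.

Lemma walk_dist u v : connect (@adj G) u v -> walk u v (dist u v).
Proof.
case/connectP=> p0 pp0 ->; case/shortenP: pp0 => p pp up _.
have ltp : size p < #|G|.
  by have := max_card [in u :: p]; rewrite (card_uniqP up).
have w : has (walk u (last u p)) (iota 0 #|G|).
  apply/hasP; exists (size p); first by rewrite mem_iota.
  by apply/walkP; exists p.
have := nth_find 0 w; rewrite nth_iota ?add0n //.
by move: w; rewrite has_find size_iota.
Qed.

Lemma dist_le_walk u v k : walk u v k -> dist u v <= k.
Proof.
move=> w; rewrite leqNgt; apply/negP => lt_k.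
have lt_kG : k < #|G|.
  by apply: leq_trans lt_k _; rewrite -[X in _ <= X](size_iota 0) find_size.
by have := before_find 0 lt_k; rewrite nth_iota // add0n w.
Qed.

End Distance.

Local Open Scope ring_scope.

Definition eps_entry (G : sgraph) (u v : G) : nat :=
  if dist u v == minn (ecc u) (ecc v) then dist u v else 0%N.

(* Rows and columns follow the enumeration of the vertices given by enum_val. *)
Definition eps_matrix (C : numClosedFieldType) (G : sgraph) : 'M[C]_#|G| :=
  \matrix_(i, j) (eps_entry (enum_val i) (enum_val j))%:R.

(* The eigenvalues of A with algebraic multiplicity, listed in some order. *)
Definition spectrum (C : numClosedFieldType) (n : nat) (A : 'M[C]_n) : seq C :=
  sval (closed_field_poly_normal (char_poly A)).

Lemma char_poly_spectrum (C : numClosedFieldType) (n : nat) (A : 'M[C]_n) :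
  char_poly A = \prod_(z <- spectrum A) ('X - z%:P).
Proof.
rewrite /spectrum; case: closed_field_poly_normal => r /= {1}->.
by rewrite (eqP (char_poly_monic A)) scale1r.
Qed.

Definition eps_spectrum (C : numClosedFieldType) (G : sgraph) : seq C :=
  spectrum (eps_matrix C G).

Definition eps_energy (C : numClosedFieldType) (G : sgraph) : C :=
  \sum_(z <- eps_spectrum C G) `|z|.

(* Spectra are multisets, hence are compared up to permutation. *)
Definition eps_cospectral (C : numClosedFieldType) (G H : sgraph) : Prop :=
  perm_eq (eps_spectrum C G) (eps_spectrum C H).

Definition eps_equienergetic (C : numClosedFieldType) (G H : sgraph) : Prop :=
  eps_energy C G = eps_energy C H.

Section Constructions.

Definition complete_adj (n : nat) : rel 'I_n := fun x y => x != y.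

Fact complete_adj_sym n : symmetric (@complete_adj n).
Proof. by move=> x y; rewrite /complete_adj eq_sym. Qed.

Fact complete_adj_irrefl n : irreflexive (@complete_adj n).
Proof. by move=> x; rewrite /complete_adj eqxx. Qed.

Definition complete_graph (n : nat) : sgraph :=
  SGraph (@complete_adj_sym n) (@complete_adj_irrefl n).

Definition multipartite_vertex (s : seq nat) : finType :=
  {k : 'I_(size s) & 'I_(nth 0%N s k)}.

Definition multipartite_adj (s : seq nat) : rel (multipartite_vertex s) :=
  fun x y => tag x != tag y.

Fact multipartite_adj_sym s : symmetric (@multipartite_adj s).
Proof. by move=> x y; rewrite /multipartite_adj eq_sym. Qed.

Fact multipartite_adj_irrefl s : irreflexive (@multipartite_adj s).
Proof. by move=> x; rewrite /multipartite_adj eqxx. Qed.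

Definition complete_multipartite (s : seq nat) : sgraph :=
  SGraph (@multipartite_adj_sym s) (@multipartite_adj_irrefl s).

Variables G H : sgraph.

Definition strong_adj : rel (G * H)%type := fun x y =>
  [&& x != y, (x.1 == y.1) || adj x.1 y.1 & (x.2 == y.2) || adj x.2 y.2].

Fact strong_adj_sym : symmetric strong_adj.
Proof.
move=> x y; rewrite /strong_adj (eq_sym x) (eq_sym x.1) (eq_sym x.2).
by rewrite (adj_sym x.1) (adj_sym x.2).
Qed.

Fact strong_adj_irrefl : irreflexive strong_adj.
Proof. by move=> x; rewrite /strong_adj eqxx. Qed.

Definition strong_product : sgraph := SGraph strong_adj_sym strong_adj_irrefl.

End Constructions.

(* Main.v *)
Require Import Defs.
From mathcomp Require Import all_boot all_order all_algebra.
From mathcomp Require Import zify ring.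

(** Both graphs have diameter two and no dominating vertex, so their
    eccentricity matrices are twice the adjacency matrices of the complements.
    For a complete multipartite graph this matrix is [2 (P P^T - 1)] with [P]
    the incidence matrix between vertices and parts, and for [G ⊠ K_m] it is
    [U ε(G) U^T] with [U^T U = m]; Sylvester's identity reduces both spectra to
    that of the diagonal matrix [P^T P].  Parts of sizes at least two with [N]
    vertices in [p] parts give energy [4 (N - p)], doubled by [⊠ K_2].
    Finally [0] is an eigenvalue of [G ⊠ K_2], but not of the other graph. *)

Set Implicit Arguments.
Unset Strict Implicit.
Unset Printing Implicit Defensive.

Import GRing.Theory Num.Theory.

(** * Sylvester's identity and its consequences for spectra *)

Section Spectra.

Local Open Scope ring_scope.

Lemma sum_enum_val (T : finType) (V : nmodType) (F : T -> V) :
  \sum_(i < #|T|) F (enum_val i) = \sum_x F x.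
Proof. by rewrite [RHS](reindex _ (onW_bij _ (enum_val_bij T))). Qed.

(** Two block eliminations of [M] compute the same determinant. The powers of [a] replace a
    division, so that [a] may be a polynomial. *)
Lemma det_scalar_sub_mulmxC (R : comNzRingType) (m k : nat) (a : R)
    (U : 'M[R]_(m, k)) (V : 'M[R]_(k, m)) :
  \det (a%:M - U *m V) * a ^+ k = \det (a%:M - V *m U) * a ^+ m.
Proof.
pose M := block_mx a%:M U V 1%:M.
have detM : \det M = \det (a%:M - U *m V).
  rewrite -[LHS]mulr1 -(det1 R (m + k)).
  (* Multiplying [M] on the right by this unipotent matrix clears its lower left block. *)
  have <- : \det (block_mx 1%:M 0 (- V) 1%:M : 'M[R]_(m + k)) =
      \det (1%:M : 'M[R]_(m + k)).
    by rewrite det_lblock !det1 mulr1.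
  rewrite -det_mulmx mulmx_block !mulmx1 !mulmx0 !mul1mx mulmxN !add0r subrr.
  by rewrite det_ublock det1 mulr1.
(* Multiplying [M] on the left by the block matrix with rows [1, 0] and [-V, a], of determinant
   [a ^+ k], leaves the diagonal blocks [a] and [a - V U]. *)
rewrite -detM mulrC -[a ^+ k]mul1r -{1}(det1 R m) -det_scalar.
rewrite -(det_lblock 1%:M (- V)) -det_mulmx mulmx_block !mul1mx !mul0mx !addr0.
rewrite mulmx1 mul_mx_scalar mul_scalar_mx scalerN addNr det_ublock det_scalar.
by rewrite mulrC mulNmx addrC.
Qed.

Variable C : numClosedFieldType.

(** Subtracting [c] from a matrix turns [X] into [X + c] in its characteristic polynomial, so this
    is Sylvester's identity at [a = X + c]. *)
Lemma char_poly_mulmxC_shift (m k : nat) (c : C)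
    (U : 'M[C]_(m, k)) (V : 'M[C]_(k, m)) :
  char_poly (U *m V - c%:M) * ('X + c%:P) ^+ k =
  char_poly (V *m U - c%:M) * ('X + c%:P) ^+ m.
Proof.
have shiftE r (A : 'M[C]_r) : char_poly (A - c%:M) =
    \det (('X + c%:P)%:M - map_mx polyC A).
  rewrite /char_poly /char_poly_mx map_mxB map_scalar_mx opprB raddfD /=.
  by rewrite addrA.
by rewrite !shiftE !map_mxM det_scalar_sub_mulmxC.
Qed.

(** A product of monic linear factors determines the multiset of its roots; the powers of [X + c]
    become the copies of [- c]. *)
Lemma spectrum_mulmxC_shift (m k : nat) (c : C)
    (U : 'M[C]_(m, k)) (V : 'M[C]_(k, m)) :
  perm_eq (spectrum (U *m V - c%:M) ++ nseq k (- c))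
          (spectrum (V *m U - c%:M) ++ nseq m (- c)).
Proof.
apply: prod_XsubC_eq; rewrite !big_cat /= -!char_poly_spectrum.
rewrite !big_nseq !iter_mulr_1.
by rewrite polyCN opprK char_poly_mulmxC_shift.
Qed.

Lemma spectrum_mulmxC (m k : nat) (U : 'M[C]_(m, k)) (V : 'M[C]_(k, m)) :
  perm_eq (spectrum (U *m V) ++ nseq k 0) (spectrum (V *m U) ++ nseq m 0).
Proof.
by have := spectrum_mulmxC_shift 0 U V; rewrite !raddf0 !addr0.
Qed.

Lemma spectrum_diag (k : nat) (d : 'rV[C]_k) :
  perm_eq (spectrum (diag_mx d)) [seq d 0 j | j <- enum 'I_k].
Proof.
apply: prod_XsubC_eq.
rewrite -char_poly_spectrum char_poly_trig ?diag_mx_is_trig //.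
by rewrite big_map big_enum; apply: eq_bigr => j _; rewrite mxE eqxx.
Qed.

(** With fewer padding copies on the left, [r1] itself must supply a [c]. *)
Lemma mem_perm_cat_nseq (T : eqType) (r1 r2 : seq T) (p q : nat) (c : T) :
  perm_eq (r1 ++ nseq p c) (r2 ++ nseq q c) -> (p < q)%N -> c \in r1.
Proof.
move=> /permP/(_ (pred1 c)); rewrite !count_cat !count_nseq /= eqxx !mul1n.
by move=> count_eq lt_pq; rewrite -has_pred1 has_count; lia.
Qed.

Lemma sum_norm_perm_cat_nseq (r1 r2 : seq C) (p q : nat) (c : C) :
  perm_eq (r1 ++ nseq p c) (r2 ++ nseq q c) ->
  \sum_(z <- r1) `|z| + `|c| *+ p = \sum_(z <- r2) `|z| + `|c| *+ q.
Proof.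
move=> r12.
have : \sum_(z <- r1 ++ nseq p c) `|z| = \sum_(z <- r2 ++ nseq q c) `|z|.
  exact: perm_big.
by rewrite !big_cat !big_nseq /= !iter_addr_0.
Qed.

End Spectra.

(** * Distances and eccentricities in diameter two *)

Section DiameterTwo.

(** The first clause bounds all distances by 2; the second makes every eccentricity exactly 2. *)
Definition diam2 (G : sgraph) :=
  [/\ forall u v : G, u != v -> ~~ adj u v -> exists2 w, adj u w & adj w v
    & forall u : G, exists2 v, u != v & ~~ adj u v].

Variable G : sgraph.
Hypothesis G2 : diam2 G.

Lemma dist_diam2 (u v : G) :
  dist u v = if u == v then 0 else if adj u v then 1 else 2.
Proof.
case: G2 => mid _.
have walk0 (x y : G) : walk x y 0 = (x == y).
  apply/walkP/eqP => [[p [/size0nil-> _]]|->] //.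
  by exists [::].
have walk1 (x y : G) : walk x y 1 = adj x y.
  apply/walkP/idP => [[[|z [|? ?]] [] // _ /=]|xy].
    by rewrite andbT => xz <-.
  by exists [:: y]; rewrite /= xy.
case: (eqVneq u v) => [->|uv].
  by apply/eqP; rewrite -leqn0 dist_le_walk ?walk0.
have [k walk_k] : exists k, walk u v k.
  case: (boolP (adj u v)) => [uv1|nuv]; first by exists 1; rewrite walk1.
  have [w uw wv] := mid _ _ uv nuv.
  by exists 2; apply/walkP; exists [:: w; v]; rewrite /= uw wv.
(* Connectedness rules out the junk value of [dist]. This walk then excludes length 0, and length 1
   when [u] and [v] are not adjacent. *)
have dist_walk : walk u v (dist u v).
  apply: walk_dist; apply/connectP; case/walkP: walk_k => p [_ pp pv].
  by exists p.
have dist_gt0 : 0 < dist u v.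
  rewrite lt0n; apply/negP => /eqP d0; move: dist_walk.
  by rewrite d0 walk0 (negPf uv).
case: (boolP (adj u v)) => [uv1|nuv].
  by apply/eqP; rewrite eqn_leq dist_gt0 dist_le_walk ?walk1.
have [w uw wv] := mid _ _ uv nuv.
have le2 : dist u v <= 2.
  by apply: dist_le_walk; apply/walkP; exists [:: w; v]; rewrite /= uw wv.
apply/eqP; rewrite eqn_leq le2 ltn_neqAle dist_gt0 andbT /=.
apply/eqP => d1; move: dist_walk.
by rewrite -d1 walk1 (negPf nuv).
Qed.

Lemma ecc_diam2 (u : G) : ecc u = 2.
Proof.
apply/eqP; rewrite eqn_leq; apply/andP; split.
  by apply/bigmax_leqP => v _; rewrite dist_diam2; case: eqP => // _; case: adj.
have [_ /(_ u)[v uv nuv]] := G2.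
apply: leq_trans (leq_bigmax v).
by rewrite dist_diam2 (negPf uv) (negPf nuv).
Qed.

Lemma eps_entry_diam2 (u v : G) :
  eps_entry u v = if (u != v) && ~~ adj u v then 2 else 0.
Proof.
rewrite /eps_entry !ecc_diam2 dist_diam2.
by case: (u == v); case: adj.
Qed.

End DiameterTwo.

(** * Strong product with a complete graph *)

Section StrongProduct.

Variables (G : sgraph) (m : nat).
Hypothesis G2 : diam2 G.

Let GK := strong_product G (complete_graph m).

(** Two second coordinates are always equal or adjacent, so only the first ones matter. *)
Lemma strong_complete_nadj (x y : GK) :
  (x != y) && ~~ adj x y = (x.1 != y.1) && ~~ adj x.1 y.1.
Proof.
rewrite /= /strong_adj /= /complete_adj orbN andbT.
rewrite negb_and negb_or negbK.
case: (eqVneq x y) => [->|_] /=; first by rewrite eqxx.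
by [].
Qed.

Lemma strong_complete_diam2 : diam2 GK.
Proof.
case: G2 => mid far; split => [x y xy nxy|x].
  have /andP[xy1 nxy1] : (x.1 != y.1) && ~~ adj x.1 y.1.
    by rewrite -strong_complete_nadj xy.
  have [w xw wy] := mid _ _ xy1 nxy1; exists (w, x.2) => /=.
    rewrite /strong_adj /= xw eqxx orbT /= andbT.
    by apply/eqP => xE; move: xw; rewrite xE adj_irrefl.
  rewrite /strong_adj /= wy orbT /complete_adj orbN !andbT.
  by apply/eqP => yE; move: wy; rewrite -yE adj_irrefl.
have [v xv nxv] := far x.1.
suff /andP[] : (x != (v, x.2) :> GK) && ~~ adj (x : GK) (v, x.2).
  by exists (v, x.2).
by rewrite strong_complete_nadj /= xv.
Qed.

Local Open Scope ring_scope.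

(** [U] is the 0/1 matrix of the projection to [G]. Moving it to the other side of the product
    creates [U^T U], the scalar [m]; zeros balance the two sizes. *)
Lemma spectrum_strong_complete (C : numClosedFieldType) :
  perm_eq (eps_spectrum C GK ++ nseq #|G| 0)
          (spectrum (m%:R *: eps_matrix C G) ++ nseq #|GK| 0).
Proof.
pose U : 'M[C]_(#|GK|, #|G|) := \matrix_(i, j) ((enum_val i).1 == enum_val j)%:R.
have UB : U *m (eps_matrix C G *m U^T) = eps_matrix C GK.
  apply/matrixP => i j; rewrite !mxE.
  rewrite (bigD1 (enum_rank (enum_val i).1)) //= big1 ?addr0 => [|k ki]; last first.
    rewrite mxE; case: eqP => [ik|_]; last by rewrite mul0r.
    by rewrite ik enum_valK eqxx in ki.
  rewrite !mxE enum_rankK eqxx mul1r.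
  rewrite (bigD1 (enum_rank (enum_val j).1)) //= big1 ?addr0 => [|k kj]; last first.
    rewrite !mxE; case: eqP => [jk|_]; last by rewrite mulr0.
    by rewrite jk enum_valK eqxx in kj.
  rewrite !mxE !enum_rankK eqxx mulr1.
  rewrite (eps_entry_diam2 strong_complete_diam2) (eps_entry_diam2 G2).
  by rewrite strong_complete_nadj.
have BU : (eps_matrix C G *m U^T) *m U = m%:R *: eps_matrix C G.
  rewrite -mulmxA -mul_mx_scalar; congr (_ *m _).
  (* Entry [(i, j)] of [U^T U] counts the vertices lying over both [i] and [j]: [m] on the diagonal,
     none elsewhere. *)
  apply/matrixP => i j; rewrite !mxE.
  under eq_bigr do rewrite !mxE.
  rewrite (sum_enum_val
    (fun x : GK => (x.1 == enum_val i)%:R * (x.1 == enum_val j)%:R)) /=.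
  rewrite -(pair_bigA _ (fun x (_ : 'I_m) =>
    (x == enum_val i)%:R * (x == enum_val j)%:R)) /=.
  rewrite (bigD1 (enum_val i)) //= [X in _ + X]big1 ?addr0 => [|x xi]; last first.
    by rewrite (negPf xi) big1 // => *; rewrite mul0r.
  rewrite eqxx sumr_const card_ord mul1r (inj_eq enum_val_inj).
  by case: eqP => _; rewrite ?mulr1n ?mulr0n ?mul0rn.
by rewrite -BU /eps_spectrum -UB; apply: spectrum_mulmxC.
Qed.

End StrongProduct.

(** * Complete multipartite graphs *)

Section Multipartite.

Variable s : seq nat.
Hypothesis s_ge2 : all (leq 2) s.
Hypothesis size_s : 1 < size s.

Let K := complete_multipartite s.

Lemma multipartite_diam2 : diam2 K.
Proof.
have part_ge2 (k : 'I_(size s)) : 1 < nth 0 s k.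
  by apply: (allP s_ge2); apply: mem_nth.
split=> [u v uv|u].
  rewrite /= /multipartite_adj negbK => /eqP uv1.
  have [k uk] : exists k, tag u != k.
    have : 0 < #|predC1 (tag u)| by rewrite cardC1 card_ord; lia.
    by case/card_gt0P => k; rewrite inE eq_sym; exists k.
  (* Vertex 0 of another part is adjacent to both [u] and [v], which share a part. *)
  exists (Tagged (fun k : 'I_(size s) => 'I_(nth 0 s k))
            (Ordinal (ltnW (part_ge2 k)))) => /=.
    exact: uk.
  by rewrite /multipartite_adj /= -uv1 eq_sym.
have [j uj] : exists j, tagged u != j.
  have : 0 < #|predC1 (tagged u)|.
    by rewrite cardC1 card_ord; have := part_ge2 (tag u); lia.
  by case/card_gt0P => j; rewrite inE eq_sym; exists j.
exists (Tagged (fun k : 'I_(size s) => 'I_(nth 0 s k)) j).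
  by rewrite -tag_eqE /tag_eq /= eqxx tagged_asE.
by rewrite /= /multipartite_adj /= eqxx.
Qed.

Lemma card_multipartite : #|K| = sumn s.
Proof.
rewrite /K /= /multipartite_vertex card_tagged -[s in RHS](mkseq_nth 0) /mkseq.
rewrite -val_enum_ord -map_comp; congr sumn.
by apply: eq_map => k /=; rewrite card_ord.
Qed.

Variable C : numClosedFieldType.

Local Open Scope ring_scope.

(** [P P^T] marks the pairs inside a part, while [P^T P] is diagonal with the part sizes. The scalar
    [a] serves two uses: 1 for the four-part graph, 2 for the matrix left by the factor [K_2]. *)
Lemma spectrum_multipartite (a : C) :
  perm_eq (spectrum (a *: eps_matrix C K) ++ nseq (size s) (- (a *+ 2)))
          ([seq a *+ 2 * (k%:R - 1) | k <- s] ++ nseq (sumn s) (- (a *+ 2))).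
Proof.
pose P : 'M[C]_(#|K|, size s) := \matrix_(i, j) (tag (enum_val i) == j)%:R.
have epsE : (a *+ 2 *: P) *m P^T - (a *+ 2)%:M = a *: eps_matrix C K.
  apply/matrixP => i j; rewrite -scalemxAl !mxE (eps_entry_diam2 multipartite_diam2).
  rewrite (bigD1 (tag (enum_val i))) //= big1 ?addr0 => [|k ki]; last first.
    by rewrite mxE eq_sym (negPf ki) mul0r.
  rewrite !mxE eqxx mul1r (inj_eq enum_val_inj) /multipartite_adj negbK eq_sym.
  case: (eqVneq i j) => [->|_] /=; first by rewrite eqxx /=; ring.
  by case: (_ == _) => /=; ring.
have diagE : P^T *m (a *+ 2 *: P) - (a *+ 2)%:M =
    diag_mx (\row_(k < size s) (a *+ 2 * ((nth 0%N s k)%:R - 1))).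
  apply/matrixP => i j; rewrite -scalemxAr !mxE.
  under eq_bigr do rewrite !mxE.
  rewrite (sum_enum_val
    (fun x : K => (tag x == i)%:R * (tag x == j)%:R)) /=.
  rewrite -(sig_big_dep (J := fun k : 'I_(size s) => 'I_(nth 0%N s k)) xpredT
    (fun _ => xpredT) (fun k _ => (k == i)%:R * (k == j)%:R)) /=.
  rewrite (bigD1 i) //= [X in _ * (_ + X)]big1 ?addr0 => [|k ki]; last first.
    by rewrite (negPf ki) big1 // => *; rewrite mul0r.
  rewrite sumr_const card_ord eqxx mul1r.
  by case: eqP => [->|_]; rewrite ?mulr1n ?mulr0n; ring.
have := spectrum_mulmxC_shift (a *+ 2) (a *+ 2 *: P) P^T.
rewrite epsE diagE -card_multipartite => /perm_trans; apply.
rewrite perm_cat2r (perm_trans (spectrum_diag _)) //.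
rewrite -[s in X in perm_eq _ X](mkseq_nth 0%N) /mkseq -val_enum_ord -!map_comp.
have rowE : (fun j => (\row_(k < size s) (a *+ 2 * ((nth 0%N s k)%:R - 1))) 0 j)
    =1 (fun k => a *+ 2 * (k%:R - 1)) \o nth 0%N s \o val.
  by move=> k; rewrite mxE.
by rewrite (eq_map rowE).
Qed.

(** With [N] vertices in [p] parts, the eigenvalues from the parts are nonnegative with sum
    [2 a (N - p)]; the eigenvalue [- 2 a] from the padding occurs [N - p] times and contributes as
    much again. *)
Lemma energy_multipartite (a : C) : 0 <= a ->
  \sum_(z <- spectrum (a *: eps_matrix C K)) `|z| =
  a *+ 4 * ((sumn s)%:R - (size s)%:R).
Proof.
move=> a_ge0.
have sumE : \sum_(z <- [seq a *+ 2 * (k%:R - 1) | k <- s]) `|z| =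
    a *+ 2 * ((sumn s)%:R - (size s)%:R).
  rewrite big_map; elim: s s_ge2 => [_|k t IH /= /andP[k_ge2 t_ge2]].
    by rewrite big_nil subrr mulr0.
  rewrite big_cons IH // ger0_norm; last first.
    by rewrite mulr_ge0 ?mulrn_wge0 // subr_ge0 ler1n ltnW.
  rewrite natrD (mulrS 1 (size t)); ring.
have := sum_norm_perm_cat_nseq (spectrum_multipartite a).
rewrite sumE normrN ger0_norm ?mulrn_wge0 // => sum_eq.
apply: (addIr (a *+ 2 *+ size s)); rewrite sum_eq; ring.
Qed.

End Multipartite.

(** * Comparison of the two graphs *)

Theorem corollary2 (C : numClosedFieldType) (n i : nat)
    (hn : (4 <= n)%N) (hi : (1 <= i <= n - 2)%N) :
  let G := strong_product (complete_multipartite [:: n; n]) (complete_graph 2) in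
  let H := complete_multipartite [:: n + i; n; n; n - i]%N in
  ~ eps_cospectral C G H /\ eps_equienergetic C G H.
Proof.
move=> G H.
have K2 : all (leq 2) [:: n; n] by rewrite /=; lia.
have H2 : all (leq 2) [:: n + i; n; n; n - i]%N by rewrite /=; lia.
have specG := spectrum_strong_complete 2 (multipartite_diam2 K2 isT) C.
have specH := spectrum_multipartite H2 isT (1 : C).
have cardK : #|complete_multipartite [:: n; n]| = (n + n)%N.
  by rewrite card_multipartite /=; lia.
have cardG : #|G| = (4 * n)%N by rewrite card_prod cardK card_ord; lia.
split.
  have G0 : 0%R \in eps_spectrum C G.
    (* Zero pads the spectrum of [G] only [2 n] times, but the other side [4 n] times. *)
    by apply: (mem_perm_cat_nseq specG); rewrite -/G cardG cardK; lia.
  (* The eigenvalues of [H] are among [2 (k - 1)] with [k >= 2] a part size, and [-2]. *)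
  have H0 : 0%R \notin eps_spectrum C H.
    have neq0 k : 1 < k -> (2 * (k%:R - 1) != 0 :> C)%R.
      move=> k_gt1; rewrite mulf_neq0 ?pnatr_eq0 // subr_eq0 (eqr_nat C k 1).
      by rewrite gtn_eqF.
    have : 0%R \notin
        [seq (1 *+ 2 * (k%:R - 1))%R : C | k <- [:: n + i; n; n; n - i]] ++
        nseq (sumn [:: n + i; n; n; n - i]) (- (1 *+ 2))%R.
      rewrite mem_cat negb_or; apply/andP; split.
        apply/mapP => -[k k_s /esym/eqP]; apply/negP/neq0.
        exact: (allP H2).
      by rewrite mem_nseq eq_sym oppr_eq0 pnatr_eq0 andbF.
    by rewrite -(perm_mem specH) mem_cat scale1r negb_or => /andP[].
  by move=> /perm_mem/(_ 0%R); rewrite G0 (negPf H0).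
(* Both energies equal [16 (n - 1)]: [8 (2 n - 2)] for [G], from [a = 2] and two parts, and
   [4 (4 n - 4)] for [H], from [a = 1] and four parts. *)
rewrite /eps_equienergetic /eps_energy.
have := sum_norm_perm_cat_nseq specG.
rewrite normr0 !mul0rn !addr0 => ->.
have := energy_multipartite H2 isT (@ler01 C); rewrite scale1r => ->.
rewrite energy_multipartite ?ler0n //= !natrD natrB; last by lia.
by ring.
Qed.
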